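(* For every positive integer $r$, $r-2 \le \pi^*(S_r) \le r + 2\sqrt{r} + 6$.
   Context: For a positive integer $n$, $[n]=\{1,\dots,n\}$ and $\mathcal{B}_n$ denotes the family of all subsets of $[n]$ ordered by inclusion. A poset $P$ is a subposet of $Q$ if $P\subseteq Q$ and $x\le_P y$ iff $x\le_Q y$; a family $\mathcal{F}\subseteq\mathcal{B}_n$ contains a copy of $P$ if some subposet of $(\mathcal{F},\subseteq)$ is isomorphic to $P$, and is $P$-free otherwise. ${\rm La}^*(n,P)$ is the maximum size of a $P$-free family $\mathcal{F}\subseteq\mathcal{B}_n$, and $\pi^*(P)=\limsup_{n\to\infty}{\rm La}^*(n,P)/\binom{n}{\lfloor n/2\rfloor}$. The standard example $S_r$ is the poset on $2r$ elements $a_1,\dots,a_r,b_1,\dots,b_r$ in which $\{a_i\}$ and $\{b_j\}$ are antichains and $b_j\le a_i$ iff $i\ne j$ (no other relations). *)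

(* Defs.v *)
From HB Require Import structures.
From mathcomp Require Import all_boot all_order all_algebra.
From mathcomp Require Import all_classical all_reals all_analysis.

Set Implicit Arguments.
Unset Strict Implicit.
Unset Printing Implicit Defensive.

Import Order.TTheory GRing.Theory Num.Theory.

(* The ground set [n] is 'I_n, so B_n is the type {set 'I_n} ordered by \subset. *)

Definition subposet_iso (d : Order.disp_t) (P : finPOrderType d) (n : nat)
    (G : {set {set 'I_n}}) : bool :=
  [exists f : {ffun P -> {set 'I_n}},
    [&& injectiveb f, f @: [set: P] == G &
        [forall x, forall y, (x <= y)%O == (f x \subset f y)]]].

Definition contains_copy (d : Order.disp_t) (P : finPOrderType d) (n : nat)
    (F : {set {set 'I_n}}) : bool :=
  [exists G : {set {set 'I_n}}, (G \subset F) && subposet_iso P G].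

Definition La_star (n : nat) (d : Order.disp_t) (P : finPOrderType d) : nat :=
  \max_(F : {set {set 'I_n}} | ~~ contains_copy P F) #|F|.

(* Extended-real valued, so that finiteness of the limsup is not presupposed. *)
Definition pi_star (R : realType) (d : Order.disp_t) (P : finPOrderType d) :
    \bar R :=
  limn_esup (fun n : nat =>
    ((La_star n P)%:R / ('C(n, n./2))%:R : R)%:E).

(* inl i is a_i and inr j is b_j. *)
Definition standard_example (r : nat) : Type := ('I_r + 'I_r)%type.

HB.instance Definition _ (r : nat) := Finite.on (standard_example r).

Definition standard_le (r : nat) (x y : standard_example r) : bool :=
  match x, y with
  | inl i, inl i' => i == i'
  | inr j, inr j' => j == j'
  | inr j, inl i => i != j
  | inl _, inr _ => false
  end.

Lemma standard_le_refl (r : nat) : reflexive (@standard_le r).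
Proof. by case=> i /=. Qed.

Lemma standard_le_anti (r : nat) : antisymmetric (@standard_le r).
Proof.
by case=> i [] j //=; rewrite ?andbF // => /andP[/eqP ->].
Qed.

Lemma standard_le_trans (r : nat) : transitive (@standard_le r).
Proof.
by move=> [] j [] i [] k //=; do ?[move=> /eqP -> // | move=> ? /eqP <- //].
Qed.

Fact standard_display : Order.disp_t. Proof. exact: Order.Disp tt tt. Qed.

HB.instance Definition _ (r : nat) :=
  Order.Le_isPOrder.Build standard_display (standard_example r)
    (@standard_le_refl r) (@standard_le_anti r) (@standard_le_trans r).

(* Main.v *)
Require Import Defs.
From HB Require Import structures.
From mathcomp Require Import all_boot all_order all_algebra all_fingroup.
From mathcomp Require Import zify.

(* Lower bound: in a copy of S_r choose x_j in b_j outside a_j. The x_j are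
   distinct and a_2 contains b_1 together with x_3, ..., x_r, so r - 2
   consecutive levels are S_r-free; take the middle ones.

   Upper bound: up to a negligible part, F lives on levels within a small
   fraction of n around n/2. Along a random maximal chain consider a member
   P = Y_k of F followed by another member at level at least k + r + 1, and put
   W = Y_(k+r+1). An element x of W outside P is good if some b in F satisfies
   x in b, b within P + x, and some a in F avoids x and contains W - x. If r
   elements are good, F contains S_r. Exchanging x with the elements of P + x
   shows that the first condition fails with probability at most 1/(k+1), and
   exchanging x with the elements outside W - x shows that the second fails
   with probability at most (width of the window)/(n/2), even after
   conditioning on P being in F. Hence if F is S_r-free, the expected number of
   members on the chain is at most r + 1 plus a small error, and LYM bounds
   the size of F. *)

Set Implicit Arguments.
Unset Strict Implicit.
Unset Printing Implicit Defensive.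

(** * Copies of the standard example *)

Lemma contains_copy_intro (d : Order.disp_t) (P : finPOrderType d) (n : nat)
    (F : {set {set 'I_n}}) (f : P -> {set 'I_n}) :
  (forall x, f x \in F) -> (forall x y, (x <= y)%O = (f x \subset f y)) ->
  contains_copy P F.
Proof.
move=> fF fle; apply/existsP; exists (f @: [set: P]); apply/andP; split.
  by apply/subsetP => A /imsetP[x _ ->].
apply/existsP; exists [ffun x => f x]; apply/and3P; split.
- apply/injectiveP => x y; rewrite !ffunE => fxy.
  by apply: Order.POrderTheory.le_anti; rewrite !fle fxy subxx.
- by apply/eqP/eq_imset => x; rewrite ffunE.
- by apply/forallP => x; apply/forallP => y; rewrite !ffunE fle.
Qed.

Lemma contains_copy_elim (d : Order.disp_t) (P : finPOrderType d) (n : nat)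
    (F : {set {set 'I_n}}) :
  contains_copy P F ->
  exists f : P -> {set 'I_n},
    (forall x, f x \in F) /\ (forall x y, (x <= y)%O = (f x \subset f y)).
Proof.
case/existsP => G /andP[GF /existsP[f /and3P[_ /eqP fG /forallP fle]]].
exists f; split=> [x|x y]; last exact/eqP/(forallP (fle x)).
by apply: (subsetP GF); rewrite -fG imset_f ?inE.
Qed.

Lemma contains_copyS (d : Order.disp_t) (P : finPOrderType d) (n : nat)
    (F G : {set {set 'I_n}}) :
  F \subset G -> contains_copy P F -> contains_copy P G.
Proof.
move=> FG /existsP[H /andP[HF HP]]; apply/existsP; exists H.
by rewrite HP (subset_trans HF).
Qed.

(** The points [x i] separate each antichain: for [i != j], [a i \subset a j] would put [x j], a
    point of [b j] and hence of [a i], into [a j]; and [b i \subset b j] would put [x i] into [a i]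
    through [b j]. *)
Lemma standard_example_copy (r n : nat) (F : {set {set 'I_n}})
    (x : 'I_r -> 'I_n) (a b : 'I_r -> {set 'I_n}) :
  (forall i, a i \in F) -> (forall i, b i \in F) ->
  (forall i, x i \in b i) -> (forall i, x i \notin a i) ->
  (forall i j, i != j -> b j \subset a i) ->
  (forall i j, ~~ (a i \subset b j)) ->
  contains_copy (standard_example r) F.
Proof.
move=> aF bF xb xa ba nab.
pose f (z : standard_example r) := match z with inl i => a i | inr j => b j end.
apply: (@contains_copy_intro _ _ _ _ f) => [[]//|[] i [] j] /=.
- change ((i == j) = (a i \subset a j)).
  case: (eqVneq i j) => [->|ij]; first by rewrite subxx.
  apply/esym/negbTE; apply: contra (xa j) => /subsetP; apply.
  exact: (subsetP (ba _ _ ij)).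
- change (false = (a i \subset b j)); exact/esym/negbTE.
- change ((j != i) = (b i \subset a j)).
  case: (eqVneq j i) => [->|ij]; last by rewrite ba.
  by apply/esym/negbTE; apply: contra (xa i) => /subsetP; apply.
- change ((i == j) = (b i \subset b j)).
  case: (eqVneq i j) => [->|ij]; first by rewrite subxx.
  apply/esym/negbTE; apply: contra (xa i) => /subsetP bb.
  by apply: (subsetP (ba _ _ ij)); apply: bb.
Qed.

Lemma standard_example_size (r n : nat) (F : {set {set 'I_n}}) :
  2 < r -> contains_copy (standard_example r) F ->
  exists A B, [/\ A \in F, B \in F & #|B| + (r - 2) <= #|A|].
Proof.
case: r => [|[|r]] // _ /contains_copy_elim[f [fF fle]].
pose a (i : 'I_r.+2) := f (inl i); pose b (i : 'I_r.+2) := f (inr i).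
have ba i j : (b j \subset a i) = (i != j) by rewrite /a /b -fle.
have x_ex i : {x | (x \in b i) && (x \notin a i)}.
  apply: sigW; have: ~~ (b i \subset a i) by rewrite ba eqxx.
  by case/subsetPn => x xb xa; exists x; rewrite xb.
pose x i := sval (x_ex i).
have xb i : x i \in b i by rewrite /x; case: (x_ex i) => y /= /andP[].
have xa i : x i \notin a i by rewrite /x; case: (x_ex i) => y /= /andP[].
have xa' i j : i != j -> x i \in a j.
  by move=> ij; apply: (subsetP (_ : b i \subset a j)) => //; rewrite ba eq_sym.
have x_inj : injective x.
  move=> i j xij; apply/eqP; apply: contraT => /xa'.
  by rewrite xij (negbTE (xa j)).
pose i0 : 'I_r.+2 := ord0; pose i1 : 'I_r.+2 := lift ord0 ord0.
exists (a i1), (b i0); split; rewrite ?fF //.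
have -> : r.+2 - 2 = #|[set x i | i in [set~ i0] :\ i1]|.
  rewrite card_imset //; have := cardsD1 i1 [set~ i0].
  by rewrite cardsC1 card_ord !inE /=; lia.
(* Such an [x i] avoids [b i0], since [b i0] lies in [a i] and [x i] does not. *)
have xaS : [set x i | i in [set~ i0] :\ i1] \subset a i1 :\: b i0.
  apply/subsetP => _ /imsetP[i + ->]; rewrite !inE => /andP[ni1 ni0].
  rewrite xa' // andbT; apply: contra (xa i); apply/subsetP.
  by rewrite ba.
have b0a : b i0 \subset a i1 by rewrite ba.
have := subset_leq_card xaS; rewrite cardsD (setIidPr b0a).
by have := subset_leq_card b0a; lia.
Qed.

(** * Unimodality of binomial coefficients *)

Lemma leq_bin_left (n k l : nat) :
  k <= l -> l <= n./2 -> 'C(n, k) <= 'C(n, l).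
Proof.
move=> kl; rewrite -(subnKC kl); elim: (l - k) => [|i IH] le_h.
  by rewrite addn0.
apply: leq_trans (IH _) _; first by lia.
have := mul_bin_left n (k + i); rewrite addnS.
have : (k + i).+1 <= n - (k + i) by lia.
nia.
Qed.

Lemma leq_bin_half (n k : nat) : 'C(n, k) <= 'C(n, n./2).
Proof.
have [kn|nk] := leqP k n; last by rewrite bin_small.
have [kh|hk] := leqP k n./2; first exact: leq_bin_left.
by rewrite -bin_sub //; apply: leq_bin_left => //; lia.
Qed.

(** * Maximal chains encoded by permutations *)

(* A permutation sends an element to its position, so [initial s k] is the k-th
   set of the maximal chain encoded by [s]. *)
Definition initial (n : nat) (s : {perm 'I_n}) (k : nat) : {set 'I_n} :=
  [set x | s x < k].

Lemma card_ord_ltn (n k : nat) : k <= n -> #|[set i : 'I_n | i < k]| = k.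
Proof.
move=> kn; rewrite cardsE -sum1_card (eq_bigl (fun i : 'I_n => i < k)) //.
by rewrite -(big_ord_widen _ (fun=> 1)) // sum1_card card_ord.
Qed.

Lemma card_initial (n : nat) (s : {perm 'I_n}) (k : nat) :
  k <= n -> #|initial s k| = k.
Proof.
move=> kn; rewrite -[RHS](card_ord_ltn kn).
rewrite -(card_preimset [set i : 'I_n | i < k] (@perm_inj _ s)).
by apply: eq_card => x; rewrite !inE.
Qed.

Lemma initialS (n : nat) (s : {perm 'I_n}) (k k' : nat) :
  k <= k' -> initial s k \subset initial s k'.
Proof. by move=> kk'; apply/subsetP => x; rewrite !inE => /leq_trans; apply. Qed.

Lemma sum_perm1 (n : nat) : \sum_(s : {perm 'I_n}) 1 = n`!.
Proof. by rewrite sum1_card -card_Sn; apply: eq_card => s; rewrite !inE. Qed.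

Lemma exists_initial (n : nat) (A : {set 'I_n}) :
  exists s : {perm 'I_n}, initial s #|A| = A.
Proof.
(* List [A] before its complement; the index in this list is the desired position. *)
pose e := enum A ++ enum (~: A).
have e_all x : x \in e by rewrite mem_cat !mem_enum !inE; case: (x \in A).
have e_size : size e = n by rewrite size_cat -!cardE cardsC card_ord.
have pos_lt x : index x e < n by rewrite -[X in _ < X]e_size index_mem.
have pos_inj : injective (fun x => Ordinal (pos_lt x)).
  by move=> x y [] /(congr1 (nth x e)); rewrite !nth_index.
exists (perm pos_inj); apply/setP => x; rewrite inE permE /= index_cat cardE.
rewrite mem_enum; case: ifP => xA; first by rewrite index_mem mem_enum xA.
by rewrite ltnNge leq_addr.
Qed.

(** Fibres over sets of equal size are left translates of one another, and together they partition
    the permutations. *)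
Lemma card_initial_fiber (n : nat) (A : {set 'I_n}) :
  'C(n, #|A|) * #|[set s : {perm 'I_n} | initial s #|A| == A]| = n`!.
Proof.
have same (B : {set 'I_n}) : #|B| = #|A| ->
    #|[set s : {perm 'I_n} | initial s #|A| == B]|
    = #|[set s : {perm 'I_n} | initial s #|A| == A]|.
  move=> BA; have [sA sAE] := exists_initial A.
  have [sB] := exists_initial B; rewrite BA => sBE.
  rewrite -[RHS](card_preimset _ (@mulgI _ (sA * sB^-1)%g)).
  have inA x : (x \in A) = (sA x < #|A|) by rewrite -{1}sAE inE.
  have inB x : (x \in B) = (sB x < #|A|) by rewrite -{1}sBE inE.
  apply: eq_card => s; rewrite !inE; apply/eqP/eqP => /setP E; apply/setP => x.
    have := E (sB^-1 (sA x))%g; rewrite inB permKV -inA => <-.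
    by rewrite !inE !permM.
  have := E (sA^-1 (sB x))%g; rewrite inA permKV -inB => <-.
  by rewrite !inE !permM permKV permK.
rewrite -[n in 'C(n, _)]card_ord -card_draws -sum_nat_const.
transitivity (\sum_(B in [set B : {set 'I_n} | #|B| == #|A|])
    #|[set s : {perm 'I_n} | initial s #|A| == B]|).
  by apply: eq_bigr => B; rewrite inE => /eqP /same ->.
rewrite -sum_perm1.
under eq_bigr => B _ do rewrite -sum1dep_card big_mkcond.
rewrite exchange_big; apply: eq_bigr => s _ /=.
have cA : #|A| <= n by rewrite -[X in _ <= X]card_ord max_card.
rewrite (bigD1 (initial s #|A|)) /=; last by rewrite inE card_initial.
by rewrite eqxx big1 // => B /andP[_ /negbTE]; rewrite eq_sym => ->.
Qed.

(** Right multiplication by a fixed transposition is a bijection, so each [i] contributes [#|B|]. A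
    bound on how many exchanges of each [s] land in [B] thus bounds [#|B|]. *)
Lemma sum_swap (n : nat) (B : {set {perm 'I_n}}) (I : {set 'I_n}) (q : 'I_n) :
  \sum_(s : {perm 'I_n}) #|[set i in I | (s * tperm i q)%g \in B]| = #|I| * #|B|.
Proof.
under eq_bigr => s _ do rewrite -sum1dep_card big_mkcondr.
rewrite exchange_big -sum_nat_const; apply: eq_bigr => i _ /=.
rewrite -big_mkcond sum1dep_card -[in RHS](card_preimset _ (@mulIg _ (tperm i q))).
by apply: eq_card => s; rewrite !inE.
Qed.

(** * Good and bad positions on a chain *)

(* If r elements of W :\: P are good in both senses, the witnesses b and a form
   a copy of S_r: each b stays inside P and its own x, each a contains W except
   its own x. *)
Definition good_below (n : nat) (F : {set {set 'I_n}}) (P : {set 'I_n})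
    (x : 'I_n) : bool :=
  [exists b in F, (x \in b) && (b \subset x |: P)].

Definition good_above (n : nat) (F : {set {set 'I_n}}) (W : {set 'I_n})
    (x : 'I_n) : bool :=
  [exists a in F, (x \notin a) && (W :\ x \subset a)].

Definition bad_below (n : nat) (F : {set {set 'I_n}}) (k j : nat) :
    {set {perm 'I_n}} :=
  [set s | (initial s k \in F) &&
    [exists x, (s x == k + j :> nat) && ~~ good_below F (initial s k) x]].

(** The second clause is supplied by any later member on the chain; the set it provides caps the
    number of bad exchanges. *)
Definition bad_above (n : nat) (F : {set {set 'I_n}}) (r k j : nat) :
    {set {perm 'I_n}} :=
  [set s | [&& initial s k \in F,
    [exists a in F, initial s (k + r.+1) \subset a] &
    [exists x, (s x == k + j :> nat) &&
               ~~ good_above F (initial s (k + r.+1)) x]]].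

Lemma bad_position (r n : nat) (F : {set {set 'I_n}}) (s : {perm 'I_n})
    (k k' : nat) :
  ~~ contains_copy (standard_example r) F -> k' <= n -> k + r.+1 <= k' ->
  initial s k \in F -> initial s k' \in F ->
  exists j : 'I_r, (s \in bad_below F k j) || (s \in bad_above F r k j).
Proof.
move=> free k'n kk' Fk Fk'; apply/existsP; apply: contraNT free.
move=> /existsPn nobad.
have pos_lt (j : 'I_r) : k + j < n by have := ltn_ord j; lia.
pose x j := (s^-1 (Ordinal (pos_lt j)))%g.
have sx j : s (x j) = k + j :> nat by rewrite /x permKV.
have xb j : good_below F (initial s k) (x j).
  apply: contraT => bad; have := nobad j.
  rewrite negb_or !inE Fk /= => /andP[/negP[]].
  by apply/existsP; exists (x j); rewrite sx eqxx.
have xa j : good_above F (initial s (k + r.+1)) (x j).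
  apply: contraT => bad; have := nobad j.
  rewrite negb_or !inE Fk /= => /andP[_ /negP[]].
  apply/andP; split.
    by apply/existsP; exists (initial s k'); rewrite Fk' initialS.
  by apply/existsP; exists (x j); rewrite sx eqxx.
have b_ex j : {b | [&& b \in F, x j \in b & b \subset x j |: initial s k]}.
  by apply: sigW; have /existsP[b] := xb j; exists b.
have a_ex j : {a | [&& a \in F, x j \notin a &
    initial s (k + r.+1) :\ x j \subset a]}.
  by apply: sigW; have /existsP[a] := xa j; exists a.
pose a j := sval (a_ex j); pose b j := sval (b_ex j).
have aP j : [&& a j \in F, x j \notin a j &
    initial s (k + r.+1) :\ x j \subset a j].
  by rewrite /a; case: (a_ex j).
have bP j : [&& b j \in F, x j \in b j & b j \subset x j |: initial s k].
  by rewrite /b; case: (b_ex j).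
apply: (@standard_example_copy r n F x a b) => [i|i|i|i|i j ij|i j].
- by case/and3P: (aP i).
- by case/and3P: (bP i).
- by case/and3P: (bP i).
- by case/and3P: (aP i).
(* [b j] lies in [x j |: initial s k], which sits in the upper set and misses [x i]: positions
   [k + i] and [k + j] differ, and neither is below [k]. *)
- case/and3P: (aP i) => _ _; apply: subset_trans.
  case/and3P: (bP j) => _ _ /subset_trans; apply; apply/subsetP => y.
  rewrite !inE => /orP[/eqP ->|yk].
    rewrite sx; have := ltn_ord j => jr; apply/andP; split; last by lia.
    apply: contraNneq ij => /(congr1 (fun z => val (s z))) /=; rewrite !sx => E.
    by apply/eqP/val_inj => /=; lia.
  apply/andP; split; last by lia.
  by apply: contraTneq yk => ->; rewrite sx; lia.
- (* The extra position k + r, never used as some x j, separates a i from b j;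
     this matters only for r <= 2. *)
  have lt_r : k + r < n by lia.
  pose z := (s^-1 (Ordinal lt_r))%g.
  have sz : s z = k + r :> nat by rewrite /z permKV.
  have zx l : z != x l.
    apply: contraTneq (ltn_ord l) => /(congr1 (fun z => val (s z))) /=.
    by rewrite sz sx; lia.
  apply/negP => /subsetP ab; have za : z \in a i.
    case/and3P: (aP i) => _ _ /subsetP; apply.
    by rewrite !inE zx sz; lia.
  case/and3P: (bP j) => _ _ /subsetP/(_ z (ab _ za)).
  by rewrite !inE (negbTE (zx j)) sz; lia.
Qed.

Lemma card_bad_below (n : nat) (F : {set {set 'I_n}}) (k j : nat) :
  k.+1 * #|bad_below F k j| <= n`!.
Proof.
have [kjn|nkj] := ltnP (k + j) n; last first.
  suff -> : bad_below F k j = set0 by rewrite cards0 muln0.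
  apply/setP => s; rewrite !inE; apply/negbTE; rewrite negb_and.
  apply/orP; right; apply/existsPn => x; have := ltn_ord (s x).
  by case: eqP => // ->; rewrite ltnNge nkj.
(* [I] holds the positions of S = P + x. Exchanging [q] with [l] in [I] keeps S and makes the
   element at position [l] the tested one. *)
pose q := Ordinal kjn; pose I := q |: [set i : 'I_n | i < k].
have cI : #|I| = k.+1.
  by rewrite cardsU1 inE /= card_ord_ltn; lia.
rewrite -cI -(sum_swap _ _ q) -sum_perm1.
(* If S minus x and S minus x' both lie in F, the latter contains x, so at most
   one x of S can be bad. *)
apply: leq_sum => s _; apply/card_le1_eqP => i i'.
have key l : l \in I -> initial (s * tperm l q)%g k =
    [set x | s x \in I] :\ (s^-1 l)%g.
  move=> lI; apply/setP => x; rewrite !inE permM -(can2_eq (permK s) (permKV s)).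
  case: tpermP => [->|->|/eqP xl /eqP xq].
  - by rewrite eqxx /=; lia.
  - move: lI; rewrite !inE eqxx andbT; case: (eqVneq l q) => [->|_] /= => [_|-> //].
    by rewrite ltnNge leq_addr.
  - by rewrite (negbTE xq) xl.
have bad l : l \in I -> (s * tperm l q)%g \in bad_below F k j ->
    initial (s * tperm l q)%g k \in F /\
    forall b, b \in F -> (s^-1 l)%g \in b -> ~~ (b \subset [set x | s x \in I]).
  move=> lI; rewrite inE => /andP[Fl /existsP[x /andP[sx /existsPn xbad]]].
  split=> // b bF lb; have := xbad b; rewrite bF /=.
  have -> : x = (s^-1 l)%g.
    apply: (@perm_inj _ (s * tperm l q)%g); apply: val_inj => /=.
    by rewrite (eqP sx) permM permKV tpermL.
  rewrite lb /=; apply: contra => bS; rewrite key // setD1K //.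
  by rewrite inE permKV.
move=> /setIdP[iI /(bad _ iI)[_ iun]] /setIdP[i'I /(bad _ i'I)[Fi' _]].
apply/eqP; apply: contraT => ii'.
suff /(iun _ Fi') : (s^-1 i)%g \in initial (s * tperm i' q)%g k.
  by rewrite key // subD1set.
by rewrite key // 2!inE (inj_eq perm_inj) eq_sym ii' inE permKV.
Qed.

Lemma card_bad_above (n : nat) (F : {set {set 'I_n}}) (lo hi r k j : nat) :
  (forall A, A \in F -> lo <= #|A| <= hi) -> j < r ->
  (n - hi) * #|bad_above F r k j|
    <= (hi - lo) * #|[set s : {perm 'I_n} | initial s k \in F]|.
Proof.
move=> Fsize jr.
have [->|[s0]] := set_0Vmem (bad_above F r k j); first by rewrite cards0 muln0.
rewrite inE => /and3P[_ /existsP[a0 /andP[a0F s0a0]] _].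
(* In the first case the member above the upper set is the whole ground set, so [n - hi]
   vanishes. *)
have [nK|Kn] := leqP n (k + r.+1).
  have := subset_leq_card (subset_trans (initialS s0 nK) s0a0).
  rewrite card_initial // => na0; case/andP: (Fsize _ a0F) => _ a0hi.
  by have /eqP -> : n - hi == 0 by rewrite subn_eq0 (leq_trans na0).
have Khi : k + r.+1 <= hi.
  have := subset_leq_card s0a0; rewrite card_initial; last by lia.
  by case/andP: (Fsize _ a0F) => _; lia.
have kjn : k + j < n by lia.
(* Exchanges between [q] and positions from [k + r.+1] on fix both P and W - x. Fixing P is what
   allows a bound relative to the chains with P in [F] instead of all chains. *)
pose q := Ordinal kjn; pose I := q |: ~: [set i : 'I_n | i < k + r.+1].
have cI : n - hi <= #|I|.
  rewrite cardsU1 cardsCs setCK card_ord card_ord_ltn; lia.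
apply: leq_trans (leq_mul cI (leqnn _)) _.
rewrite -(sum_swap _ _ q) -sum1dep_card big_distrr /= [X in _ <= X]big_mkcond.
apply: leq_sum => s _; rewrite muln1.
pose T := [set x | (s x < k + r.+1) && (s x != q)].
have init l : l \in I -> initial (s * tperm l q)%g k = initial s k.
  move=> lI; have kl : k <= l.
    by move: lI; rewrite !inE; case: eqP => [->|_] /=; lia.
  apply/setP => x; rewrite !inE permM.
  by case: tpermP => // ->; rewrite !ltnNge /= leq_addr kl.
have top l : l \in I -> initial (s * tperm l q)%g (k + r.+1) :\ (s^-1 l)%g = T.
  move=> lI; apply/setP => x; rewrite !inE permM -(can2_eq (permK s) (permKV s)).
  case: tpermP => [->|->|/eqP xl /eqP xq].
  - by move: lI; rewrite !inE eqxx; case: eqP => //=; lia.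
  - rewrite eqxx andbF; move: lI; rewrite !inE eq_sym; case: eqP => //=; lia.
  - by rewrite xl xq andbT.
have bad l : l \in I -> (s * tperm l q)%g \in bad_above F r k j ->
    [/\ initial s k \in F, exists2 a, a \in F & T \subset a &
     forall a, a \in F -> T \subset a -> (s^-1 l)%g \in a].
  move=> lI; rewrite inE => /and3P[Fl /existsP[a /andP[aF aT]]].
  move=> /existsP[x /andP[sx /existsPn xbad]].
  have xE : x = (s^-1 l)%g.
    apply: (@perm_inj _ (s * tperm l q)%g); apply: val_inj => /=.
    by rewrite (eqP sx) permM permKV tpermL.
  rewrite init // in Fl; split=> //.
    by exists a => //; apply: subset_trans aT; rewrite -(top l lI) subD1set.
  move=> b bF Tb; have := xbad b; rewrite bF xE top // Tb andbT /=.
  by rewrite negbK.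
set J := [set i in I | _].
have [->|[l]] := set_0Vmem J; first by rewrite cards0.
rewrite inE => /andP[lI /(bad _ lI)[Fs [a aF Ta] _]].
(* A bad x lies in every member of F above T, hence in the single set a. *)
rewrite Fs; apply: (@leq_trans #|a :\: T|).
  rewrite -(card_preimset _ (@perm_inj _ (s^-1)%g)).
  apply: subset_leq_card; apply/subsetP => i.
  move=> /setIdP[iI /(bad _ iI)[_ _ /(_ _ aF Ta) ia]].
  rewrite !inE ia permKV andbT; move: iI; rewrite !inE.
  by case: eqP => //= _; lia.
(* [T] contains a member of [F], so it has at least [lo] elements and [a :\: T] at most
   [hi - lo]. *)
have sT : initial s k \subset T.
  apply/subsetP => x; rewrite !inE => xk.
  by apply/andP; split; [|rewrite -val_eqE /=]; lia.
have := subset_leq_card sT; rewrite cardsD (setIidPr Ta).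
by case/andP: (Fsize _ aF) => _; case/andP: (Fsize _ Fs); lia.
Qed.

(** * Averaging the hits over all chains *)

Definition hits (n : nat) (F : {set {set 'I_n}}) (s : {perm 'I_n}) :
    {set 'I_n.+1} := [set k : 'I_n.+1 | initial s k \in F].

(** Hits in [E], those followed by another at least [r.+1] levels higher, are each charged to a bad
    event. The other hits fit in [r.+1] consecutive levels starting at the lowest of them. *)
Lemma card_hits (r n : nat) (F : {set {set 'I_n}}) (s : {perm 'I_n}) :
  ~~ contains_copy (standard_example r) F ->
  #|hits F s| <= r.+1 + \sum_(k < n.+1) \sum_(j < r)
    ((s \in bad_below F k j) + (s \in bad_above F r k j)).
Proof.
move=> free; pose E := [set k in hits F s | [exists l in hits F s, k + r.+1 <= l]].
rewrite -(cardsID E (hits F s)) addnC; apply: leq_add.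
  have [->|[k0 k0E]] := set_0Vmem (hits F s :\: E); first by rewrite cards0.
  have [k kE kmin] := @arg_minnP _ k0 (mem (hits F s :\: E)) val k0E.
  have kn : forall l, l \in hits F s -> l < k + r.+1.
    move=> l lF; rewrite ltnNge; apply/negP => kl.
    move: kE; rewrite /= inE => /andP[/negP + kF]; apply.
    by rewrite inE kF; apply/existsP; exists l; rewrite lF.
  have sub : hits F s :\: E \subset
      [set i : 'I_n.+1 | i < k + r.+1] :\: [set i : 'I_n.+1 | i < k].
    apply/subsetP => l lE; rewrite !inE -leqNgt kmin //=.
    by apply: kn; move: lE; rewrite inE => /andP[].
  apply: leq_trans (subset_leq_card sub) _.
  have [kr|kr] := leqP (k + r.+1) n.+1.
    rewrite cardsD (setIidPr _); last first.
      by apply/subsetP => i; rewrite !inE; lia.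
    by rewrite !card_ord_ltn; lia.
  apply: leq_trans (subset_leq_card (_ : _ \subset ~: [set i : 'I_n.+1 | i < k])) _.
    by apply/subsetP => i; rewrite !inE => /andP[].
  by rewrite cardsCs setCK card_ord card_ord_ltn; have := ltn_ord k; lia.
rewrite -sum1_card big_mkcond /=; apply: leq_sum => k _.
case: ifP => //; rewrite !inE => /andP[_ /andP[Fk /existsP[l]]].
rewrite inE => /andP[Fl kl].
have ln : l <= n by rewrite -ltnS ltn_ord.
have [j jbad] := bad_position free ln kl Fk Fl.
rewrite (bigD1 j) //=; apply: leq_trans (leq_addr _ _).
by case/orP: jbad => ->; rewrite ?addn1 ?add1n.
Qed.

Lemma sum_hits (n : nat) (F : {set {set 'I_n}}) :
  \sum_(s : {perm 'I_n}) #|hits F s|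
    = \sum_(k < n.+1) #|[set s : {perm 'I_n} | initial s k \in F]|.
Proof.
under eq_bigr do rewrite -sum1dep_card big_mkcond.
rewrite exchange_big; apply: eq_bigr => k _.
by rewrite -sum1dep_card [in RHS]big_mkcond.
Qed.

Lemma sum_card_mem (T : finType) (B : {set T}) : \sum_(x : T) (x \in B) = #|B|.
Proof.
by rewrite -sum1_card [RHS]big_mkcond; apply: eq_bigr => x _; case: (x \in B).
Qed.

Lemma sum_interval_leq (m lo hi : nat) :
  \sum_(k < m) (lo <= k <= hi) <= (hi - lo).+1.
Proof.
suff: \sum_(k < m) (lo <= k <= hi) <= minn m hi.+1 - lo by lia.
elim: m => [|m IH]; first by rewrite big_ord0.
rewrite big_ord_recr /=; move: (\sum_(k < m) _) IH => S.
by case: (boolP (lo <= m <= hi)) => /=; lia.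
Qed.

(** The single factor [m] serves both error bounds, being at most [k.+1] for [k] in the window and
    at most [n - hi]. The errors from above return a multiple of the very sum being bounded. *)
Lemma sum_hits_bound (r n lo hi m : nat) (F : {set {set 'I_n}}) :
  ~~ contains_copy (standard_example r) F ->
  (forall A, A \in F -> lo <= #|A| <= hi) -> m <= lo.+1 -> m <= n - hi ->
  m * \sum_(s : {perm 'I_n}) #|hits F s| <=
    r.+1 * m * n`! + r * (hi - lo).+1 * n`!
    + r * (hi - lo) * \sum_(s : {perm 'I_n}) #|hits F s|.
Proof.
move=> free Fsize mlo mhi.
have below k j : m * #|bad_below F k j| <= (lo <= k <= hi) * n`! \/ n < k.
  have [kn|] := leqP k n; last by right.
  left; have [->|[s]] := set_0Vmem (bad_below F k j); first by rewrite cards0 muln0.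
  rewrite inE => /andP[/Fsize + _]; rewrite card_initial // => kb; rewrite kb mul1n.
  apply: leq_trans (card_bad_below F k j); rewrite leq_mul2r; lia.
apply: (@leq_trans (m * (r.+1 * n`! + \sum_(k < n.+1) \sum_(j < r)
    (#|bad_below F k j| + #|bad_above F r k j|)))).
  rewrite leq_mul2l; apply/orP; right.
  apply: leq_trans (leq_sum _ (fun s _ => card_hits s free)) _.
  rewrite big_split /= [X in X + _ <= _](_ : _ = r.+1 * n`!); last first.
    by rewrite -sum_perm1 big_distrr /=; apply: eq_bigr => s _; rewrite muln1.
  rewrite leq_add2l.
  rewrite exchange_big /=; apply: leq_sum => k _.
  rewrite exchange_big /=; apply: leq_sum => j _.
  by rewrite big_split /= !sum_card_mem.
rewrite mulnDr mulnA [m * _]mulnC -addnA leq_add2l sum_hits.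
apply: (@leq_trans (\sum_(k < n.+1) \sum_(j < r) ((lo <= k <= hi) * n`! +
   (hi - lo) * #|[set s : {perm 'I_n} | initial s k \in F]|))).
  rewrite big_distrr /=; apply: leq_sum => k _; rewrite big_distrr /=.
  apply: leq_sum => j _; rewrite mulnDr; apply: leq_add.
    by case: (below k j) => //; have := ltn_ord k; lia.
  apply: leq_trans (card_bad_above _ Fsize (ltn_ord j)).
  by rewrite leq_mul2r mhi orbT.
under eq_bigr do rewrite sum_nat_const card_ord mulnDr.
rewrite big_split /= -!big_distrr /= -!mulnA leq_add2r -big_distrl /=.
by rewrite !leq_mul2l leq_mul2r sum_interval_leq !orbT.
Qed.

(** By [card_initial_fiber], each member of [F] is on at least the fraction [1 / 'C(n, n./2)] of all
    chains; members on one chain have distinct sizes. *)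
Lemma lym_hits (n : nat) (F : {set {set 'I_n}}) :
  #|F| * n`! <= 'C(n, n./2) * \sum_(s : {perm 'I_n}) #|hits F s|.
Proof.
have size_le (A : {set 'I_n}) : #|A| <= n.
  by rewrite -[X in _ <= X]card_ord max_card.
rewrite -sum_nat_const.
apply: (@leq_trans (\sum_(A in F) 'C(n, n./2) *
    #|[set s : {perm 'I_n} | initial s #|A| == A]|)).
  apply: leq_sum => A _; rewrite -(card_initial_fiber A).
  by rewrite leq_mul2r leq_bin_half orbT.
rewrite -big_distrr /= leq_mul2l; apply/orP; right.
under eq_bigr do rewrite -sum1dep_card big_mkcond.
rewrite exchange_big; apply: leq_sum => s _ /=.
rewrite -big_mkcondr sum1dep_card.
rewrite -(@card_in_imset _ _ (fun A : {set 'I_n} => inord #|A| : 'I_n.+1)).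
  apply: subset_leq_card; apply/subsetP => _ /imsetP[A + ->].
  by rewrite !inE => /andP[AF /eqP sA]; rewrite inordK ?ltnS // sA.
move=> A B; rewrite !inE => /andP[_ /eqP sA] /andP[_ /eqP sB] /(congr1 val).
by rewrite /= !inordK ?ltnS // => AB; rewrite -[LHS]sA -[RHS]sB AB.
Qed.

Lemma card_middle_family (r n t : nat) (F : {set {set 'I_n}}) :
  ~~ contains_copy (standard_example r) F ->
  (forall A, A \in F -> n./2 - t <= #|A| <= n./2 + t) ->
  r * (r + 8) * (t.*2).+1 < n./2 - t ->
  #|F| <= (r + 7) * 'C(n, n./2).
Proof.
move=> free Fsize t_small; pose h := n./2; pose m := h - t; pose d := (t.*2).+1.
have := sum_hits_bound (m := m) free Fsize; move: (lym_hits F).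
set L := \sum_(s : _) _; have := fact_gt0 n; move: (n`!) => f f0 lym.
have -> : h + t - (h - t) = t.*2 by lia.
move=> bound.
have {}bound : m * L <= r.+1 * m * f + r * d * f + r * t.*2 * L.
  by apply: bound; lia.
have L_le : L <= (r + 7) * f.
  rewrite leqNgt; apply/negP => fL.
  have bound' : m * L <= r.+1 * m * f + r * d * f + r * d * L.
    by apply: leq_trans bound _; rewrite leq_add2l leq_mul2r leq_mul2l leqnSn !orbT.
  have md : r * (r + 8) * d < m by [].
  have rd_m : r * d < m by nia.
  (* Absorbing the term in [L] leaves a contradiction with [L > (r + 7) * f] as soon as
     [r * (r + 8) * d < 6 * m]. *)
  have : (m - r * d) * L <= (r.+1 * m + r * d) * f.
    by rewrite mulnBl mulnDl leq_subLR; lia.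
  apply/negP; rewrite -ltnNge.
  apply: (@leq_ltn_trans ((m - r * d) * ((r + 7) * f))); last first.
    by rewrite ltn_pmul2l // subn_gt0.
  rewrite mulnA leq_mul2r; apply/orP; right.
  move: (r * d) md rd_m => x; nia.
rewrite -(leq_pmul2r f0) (leq_trans lym) //.
by rewrite -mulnA mulnCA leq_mul2l L_le orbT.
Qed.

(** * Binomial tails *)

(** Bernoulli's inequality for (1 + c/a)^t, cleared of denominators. *)
Lemma bernoulli_nat (a c t : nat) : a ^ t * (a + t * c) <= a * (a + c) ^ t.
Proof.
elim: t => [|t IH]; first by rewrite !expn0 mul0n addn0 mul1n muln1.
rewrite !expnS mulnCA; apply: leq_trans (leq_mul (leqnn (a + c)) IH).
rewrite [X in _ <= X]mulnCA -mulnA mulnCA leq_mul2l; apply/orP; right; nia.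
Qed.

Lemma bin_drop (n a b i : nat) : a + b <= n.+1 -> i <= a ->
  'C(n, a - i) * b ^ i <= a ^ i * 'C(n, a).
Proof.
move=> abn; elim: i => [|i IH] ia; first by rewrite subn0 mulnC.
have step : 'C(n, a - i.+1) * b <= a * 'C(n, a - i).
  have := mul_bin_left n (a - i.+1); rewrite subnSK //.
  have : b <= n - (a - i.+1) by lia.
  nia.
rewrite !expnS mulnA; apply: leq_trans (leq_mul step (leqnn _)) _.
by rewrite -!mulnA leq_mul2l IH ?orbT // ltnW.
Qed.

(** Going down [t.*2] levels from [a] costs a factor of at least (b/a)^(2t), which Bernoulli bounds
    below by (2t^2/a)^2; as 2a is at most n, this is at least 16t^4/n^2. *)
Lemma bin_far (n t : nat) :
  3 * t < n./2 -> n.+1 * n ^ 2 <= 16 * t ^ 4 ->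
  n.+1 * 'C(n, n./2 - 3 * t) <= 'C(n, n./2).
Proof.
move=> th nt; pose a := n./2 - t; pose b := a + t.*2.
have a_gt0 : 0 < a by lia.
have abn : a + b <= n.+1 by rewrite /b /a; lia.
have ta : t.*2 <= a by rewrite /a; lia.
have := bin_drop abn ta; have -> : a - t.*2 = n./2 - 3 * t by lia.
move: ('C(n, _ - _)) => c drop.
have ca := leq_bin_half n a.
have := bernoulli_nat a t.*2 t; rewrite -/b => bern.
have sq : a ^ t.*2 * (4 * t ^ 4) <= a ^ 2 * b ^ t.*2.
  rewrite -muln2 !expnM -!expnMn.
  have -> : 4 * t ^ 4 = (t * t.*2) ^ 2 by rewrite -muln2 !expnMn; lia.
  rewrite -!expnMn leq_sqr; apply: leq_trans bern.
  by rewrite leq_mul2l leq_addl orbT.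
have c_le : c * (4 * t ^ 4) <= a ^ 2 * 'C(n, n./2).
  rewrite -(@leq_pmul2l (a ^ t.*2)) ?expn_gt0 ?a_gt0 //.
  rewrite mulnCA; apply: leq_trans (leq_mul (leqnn c) sq) _.
  rewrite mulnCA [X in _ <= X]mulnCA leq_mul2l; apply/orP; right.
  by apply: leq_trans drop _; rewrite leq_mul2l ca orbT.
have a2 : (2 * a) ^ 2 <= n ^ 2 by rewrite leq_sqr; lia.
have cut : n.+1 * a ^ 2 <= 4 * t ^ 4.
  rewrite -(@leq_pmul2l 4) // mulnCA [X in _ <= X]mulnA.
  by apply: leq_trans nt; rewrite leq_mul2l -(expnMn 2 a 2) a2 orbT.
rewrite -(@leq_pmul2l (a ^ 2)) ?expn_gt0 ?a_gt0 //.
apply: leq_trans c_le; rewrite mulnCA mulnA mulnC leq_mul2l.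
by rewrite cut orbT.
Qed.

Lemma card_far_sets (n t : nat) :
  3 * t < n./2 -> n.+1 * n ^ 2 <= 16 * t ^ 4 ->
  #|[set A : {set 'I_n} | ~~ (n./2 - 3 * t <= #|A| <= n./2 + 3 * t)]|
    <= 'C(n, n./2).
Proof.
move=> th nt; apply: leq_trans (bin_far th nt).
pose level (A : {set 'I_n}) : 'I_n.+1 := inord #|A|.
rewrite -sum1_card (partition_big level xpredT) //=.
rewrite -[n.+1 in X in _ <= X]card_ord -sum_nat_const; apply: leq_sum => k _.
have kn : k <= n by rewrite -ltnS ltn_ord.
rewrite sum1dep_card.
have [kout|kin] := boolP (n./2 - 3 * t <= k <= n./2 + 3 * t).
  apply: leq_trans (_ : 0 <= _) => //; rewrite leqn0 cards_eq0; apply/eqP/setP => A.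
  rewrite !inE; apply/negbTE; rewrite negb_and negbK; apply/orP.
  have [Ak|/eqP Ak] := eqVneq #|A| k; [left|right]; first by rewrite Ak.
  apply/eqP => /(congr1 val) /=; rewrite inordK ?ltnS //.
  by rewrite -[X in _ <= X]card_ord max_card.
apply: (@leq_trans 'C(n, k)).
  rewrite -[n in 'C(n, _)]card_ord -card_draws; apply: subset_leq_card.
  apply/subsetP => A; rewrite !inE => /andP[_ /eqP/(congr1 val)] /=.
  by rewrite inordK ?ltnS; [move=> ->|rewrite -[X in _ <= X]card_ord max_card].
have [kh|hk] := leqP k n./2; first by apply: leq_bin_left; lia.
by rewrite -bin_sub //; apply: leq_bin_left; lia.
Qed.

(** * Bounds on [La_star] for fixed [n] *)

Lemma La_star_upper (r n : nat) : 0 < r -> (24 * (r + 8) ^ 2) ^ 4 <= n ->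
  La_star n (standard_example r) <= (r + 8) * 'C(n, n./2).
Proof.
move=> r0; set Q := 24 * _ => Qn; apply/bigmax_leqP => F free.
(* The window [3 * t] is a fraction of [n] small enough for [card_middle_family], while [Q ^ 3 <= t]
   makes it wide enough for [card_far_sets]. These contribute [r + 7] and 1. *)
pose t := n %/ Q.
have Q0 : 0 < Q by rewrite /Q; nia.
have tQ : Q ^ 3 <= t by rewrite leq_divRL // -expnSr.
have ltnt : n < Q * t.+1 by rewrite mulnC -ltn_divLR // ltnSn.
have letn : Q * t <= n by rewrite mulnC leq_trunc_div.
have Qt : Q <= t by apply: leq_trans tQ; rewrite -[X in X <= _]expn1 leq_pexp2l.
have t0 : 0 < t by apply: leq_trans Qt.
have Qbig : r * (r + 8) * 24 + 24 <= Q by rewrite /Q; nia.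
have th : 3 * t < n./2 by nia.
have small : r * (r + 8) * ((3 * t).*2).+1 < n./2 - 3 * t.
  move: (r * (r + 8)) Qbig => u Qbig.
  have utn : (u * 24 + 24) * t <= n.
    by apply: leq_trans letn; rewrite leq_mul2r Qbig orbT.
  have : u <= u * t by rewrite leq_pmulr.
  have -> : (3 * t).*2.+1 = 6 * t + 1 by lia.
  move: utn; rewrite mulnDl mulnAC mulnDr mulnCA; move: (u * t) => v; lia.
have nt : n.+1 * n ^ 2 <= 16 * t ^ 4.
  have n2 : n.+1 <= 2 * Q * t.
    apply: leq_trans ltnt _; rewrite mulnS -mulnA mul2n -addnn leq_add2r.
    by rewrite leq_pmulr.
  have nn : n <= 2 * Q * t by lia.
  apply: leq_trans (leq_mul n2 (leq_mul nn nn)) _.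
  rewrite (_ : _ * _ = 8 * (Q ^ 3 * t ^ 3)); last by lia.
  rewrite (expnS t 3); move: (t ^ 3) (Q ^ 3) tQ => x y yt.
  by rewrite leq_mul // leq_mul2r yt orbT.
rewrite -(cardsID [set A : {set 'I_n} | n./2 - 3 * t <= #|A| <= n./2 + 3 * t] F).
rewrite (addnS r 7) mulSn addnC; apply: leq_add.
  apply: leq_trans (card_far_sets th nt); apply: subset_leq_card.
  by apply/subsetP => A; rewrite !inE => /andP[].
apply: (@card_middle_family _ _ (3 * t)) => //.
  by apply: contra free; apply: contains_copyS; rewrite subsetIl.
by move=> A; rewrite !inE => /andP[].
Qed.

(** The step from [n./2 + i] to the next level loses at most (2i+1)/(n./2 + 1) of the central
    coefficient, and the first i odd numbers sum to i^2. *)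
Lemma bin_near_half (n i : nat) :
  (n./2).+1 * 'C(n, n./2) <= (n./2).+1 * 'C(n, n./2 + i) + i ^ 2 * 'C(n, n./2).
Proof.
elim: i => [|i IH]; first by rewrite addn0 leq_addr.
have := leq_bin_half n (n./2 + i); have := mul_bin_left n (n./2 + i).
rewrite addnS; move: ('C(n, n./2 + i)) ('C(n, (n./2 + i).+1)) ('C(n, n./2)) IH.
move=> c c' c0 IH E cc0.
suff : (n./2).+1 * c <= (n./2).+1 * c' + (2 * i).+1 * c0 by nia.
have [le|lt] := leqP c c'; first by nia.
have h : n./2 <= n - (n./2 + i) + i by lia.
have [e ce] : exists e, c = c' + e by exists (c - c'); lia.
suff : (n./2).+1 * e <= (2 * i).+1 * c0 by nia.
have : n./2 * c <= (n - (n./2 + i) + i) * c by rewrite leq_mul2r h orbT.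
rewrite mulnDl -E; nia.
Qed.

Lemma La_star_lower (r n : nat) :
  (n./2).+1 * ((r - 2) * 'C(n, n./2)) <=
  (n./2).+1 * La_star n (standard_example r) + (r - 2) * (r ^ 2 * 'C(n, n./2)).
Proof.
have [r2|r2] := leqP r 2.
  have -> : r - 2 = 0 by lia.
  by rewrite mul0n muln0.
(* Sizes in these [r - 2] levels differ by less than [r - 2], the gap that a copy forces. *)
pose F := [set A : {set 'I_n} | n./2 <= #|A| < n./2 + (r - 2)].
have free : ~~ contains_copy (standard_example r) F.
  apply/negP => /(standard_example_size r2)[A [B []]].
  by rewrite !inE => /andP[_ ?] /andP[? _]; lia.
have cF : \sum_(i < r - 2) 'C(n, n./2 + i) <= #|F|.
  rewrite -sum1_card.
  have -> : \sum_(A in F) 1 = \sum_(i < r - 2) \sum_(A in F | #|A| == n./2 + i) 1.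
    rewrite (exchange_big_dep (mem F)) /=; last by move=> i A _ /andP[].
    apply: eq_bigr => A; rewrite inE => /andP[hA Ah].
    have Ai : #|A| - n./2 < r - 2 by lia.
    rewrite (big_pred1 (Ordinal Ai)) // => i /=.
    by rewrite hA Ah -val_eqE /= -(eqn_add2l n./2 i) subnKC // eq_sym.
  apply: leq_sum => i _; rewrite sum1dep_card -[n in 'C(n, _)]card_ord -card_draws.
  apply: subset_leq_card; apply/subsetP => A; rewrite !inE => /eqP ->.
  by rewrite eqxx leq_addr ltn_add2l ltn_ord.
have : #|F| <= La_star n (standard_example r).
  exact: (leq_bigmax_cond (F := fun F : {set {set 'I_n}} => #|F|)).
move=> /(leq_trans cF) cL.
apply: leq_trans (leq_add (leq_mul (leqnn _) cL) (leqnn _)).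
rewrite -[r - 2 in X in X <= _]card_ord -[r - 2 in X in _ <= _ + X]card_ord.
rewrite -!sum_nat_const !big_distrr /= -big_split /=; apply: leq_sum => i _.
apply: leq_trans (bin_near_half n i) _; rewrite leq_add2l leq_mul2r leq_sqr.
by rewrite (leq_trans (ltnW (ltn_ord i))) ?orbT // leq_subr.
Qed.

(* Passage to the limsup *)
From mathcomp Require Import all_classical all_reals all_analysis.

Import Order.TTheory GRing.Theory Num.Theory.
Local Open Scope ring_scope.

Lemma limn_esup_le_near (R : realType) (u : nat -> \bar R) (c : \bar R) (N : nat) :
  (forall n, (N <= n)%N -> (u n <= c)%E) -> (limn_esup u <= c)%E.
Proof.
move=> uc; apply: (@le_trans _ _ (ereal_sup (u @` [set n | (N <= n)%N])%classic)).
  by apply: ereal_inf_lbound; exists [set n | (N <= n)%N]%classic => //; exists N.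
by apply: ge_ereal_sup => _ [n /= Nn <-]; exact: uc.
Qed.

Lemma limn_esup_ge_near (R : realType) (u : nat -> \bar R) (c : R) :
  (forall e : R, 0 < e ->
     exists N, forall n, (N <= n)%N -> ((c - e)%:E <= u n)%E) ->
  (c%:E <= limn_esup u)%E.
Proof.
move=> uc; apply/lee_addgt0Pr => e e0; rewrite -leeBlDr // -EFinB.
have [N uN] := uc e e0; apply: le_ereal_inf_tmp => _ [V [M _ MV] <-].
apply: le_trans (uN _ (leq_maxl N M)) _; apply: ereal_sup_ubound.
by exists (maxn N M) => //; apply: MV => /=; exact: leq_maxr.
Qed.

Theorem theorem3p13 (R : realType) (r : nat) (hr : (0 < r)%N) :
  ((r%:R - 2 : R)%:E <= pi_star R (standard_example r))%E /\
  (pi_star R (standard_example r) <= (r%:R + 2 * Num.sqrt r%:R + 6 : R)%:E)%E.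
Proof.
have C_gt0 n : 0 < ('C(n, n./2))%:R :> R by rewrite ltr0n bin_gt0; lia.
split.
  apply: limn_esup_ge_near => e e0.
  (* For [n] at least [M.*2], [n./2.+1] exceeds [M], so the error in [La_star_lower] is at most [e]
     times the central coefficient. *)
  have [M Me] : exists M : nat, ((r - 2) * r ^ 2)%:R / e < M%:R.
    by exists (Num.bound (((r - 2) * r ^ 2)%:R / e)); apply: archi_boundP;
       rewrite divr_ge0 // ltW.
  exists M.*2 => n Mn; rewrite lee_fin.
  have h_gt0 : 0 < (n./2.+1)%:R :> R by rewrite ltr0n.
  rewrite ler_pdivlMr // -(ler_pM2l h_gt0).
  have := La_star_lower r n; rewrite -(ler_nat R) natrD !natrM => low.
  have err : (r - 2)%:R * (r%:R * r%:R) <= n./2.+1%:R * e :> R.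
    rewrite -ler_pdivrMr // -!natrM; apply: ltW; apply: lt_le_trans Me _.
    by rewrite ler_nat; lia.
  (* Only an inequality, because the subtraction on the right is truncated when [r] is 1. *)
  have r_le : r%:R - 2 <= (r - 2)%:R :> R.
    by rewrite lerBlDr -natrD ler_nat; lia.
  have {}err := ler_wpM2r (ltW (C_gt0 n)) err.
  have {}r_le := ler_wpM2l (ltW h_gt0) (ler_wpM2r (ltW (C_gt0 n)) r_le).
  move: low err r_le; rewrite !mulrBl !mulrBr !mulrA => low err r_le.
  rewrite -!lerBlDr in low; apply: le_trans low.
  by rewrite lerB.
apply: (@limn_esup_le_near _ _ _ ((24 * (r + 8) ^ 2) ^ 4)) => n nN.
rewrite lee_fin ler_pdivrMr //.
have := La_star_upper hr nN; rewrite -(ler_nat R) => /le_trans; apply.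
rewrite natrM ler_pM2r // natrD -addrA lerD2l.
(* As [r] is positive, 8 = 2 + 6 is at most 2 sqrt(r) + 6. *)
have : 1 <= Num.sqrt r%:R :> R by rewrite -[leLHS]sqrtr1 ler_wsqrtr // ler1n.
move=> s1; rewrite -[8%:R]/((2 + 6)%:R) natrD lerD2r.
by rewrite ler_peMr.
Qed.
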